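(* Let $\mathcal{P}$ be a computational problem and let $F_{\mathcal{P}}$ be a lower bound on the I/O complexity of $\mathcal{P}$ in the external memory model with internal memory size $M=3m+O(1)$ and block length $B=1$. Then any algorithm for $\mathcal{P}$ in the weak $(m,\ell)$-TCU model requires $\Omega(F_{\mathcal{P}})$ time.
   Context: The external memory model consists of an external memory of unbounded size, an internal memory of $M\ge 1$ words, and a processor that can only operate on data in internal memory; data move between external and internal memory in blocks of $B\ge 1$ words. The I/O complexity of an algorithm is the number of blocks moved between the two memories. The weak $(m,\ell)$-TCU model (parameters $m\ge 1$, $\ell\ge 0$) is the standard RAM model whose CPU additionally contains a tensor unit that, via a constant-size instruction specifying the memory addresses of operands and output, multiplies two $\sqrt{m}\times\sqrt{m}$ matrices and writes the product to memory, each call costing $\Theta(m)$ time plus latency $\ell$ (i.e., $O(m+\ell)$); unlike the (non-weak) TCU model, it cannot multiply taller $N\times\sqrt{m}$ left matrices in one call. The running time of an algorithm is the total cost of all operations performed, including all calls to the tensor unit. *)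

(* Defs.v *)
From HB Require Import structures.
From mathcomp Require Import all_boot all_order all_algebra.
From mathcomp Require Import all_classical all_reals ereal.

Set Implicit Arguments.
Unset Strict Implicit.
Unset Printing Implicit Defensive.

Import Order.TTheory GRing.Theory Num.Theory.
Local Open Scope classical_set_scope.
Local Open Scope ring_scope.

(* The words handled by a machine: entries of matrices, but also codes of
   natural numbers used as addresses and lengths.  Every processor can add and
   multiply words; [word_prim] collects its other (at most binary) one-step
   operations: subtraction, comparison, shifts...  Typical instances are the
   kappa-bit words 'Z_(2 ^ kappa) with [word_nat] := val, or [int] with
   [word_nat] := absz. *)
Record word_arch := WordArch {
  word :> pzSemiRingType;
  word_prim : Type;
  prim_sem : word_prim -> word -> word -> word;
  word_nat : word -> nat;
  nat_word : nat -> word;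
  (* every number that has a code is coded by [nat_word] *)
  nat_wordK : forall w, word_nat (nat_word (word_nat w)) = word_nat w
}.

Definition memory (W : word_arch) := nat -> W.

(* A sequence of words in memory: its length in cell 0, its items after it. *)
Definition store_seq (W : word_arch) (x : seq W) : memory W :=
  fun a => if a is i.+1 then nth 0 x i else nat_word W (size x).

Definition load_seq (W : word_arch) (mem : memory W) : seq W :=
  mkseq (fun i => mem i.+1) (word_nat (mem 0%N)).

(* [answer x y]: y is a correct output on the instance x. *)
Record problem (W : word_arch) := Problem {
  instance : seq W -> Prop;
  answer : seq W -> seq W -> Prop;
  input_size : seq W -> nat
}.

Record machine (R : realType) (W : word_arch) := Machine {
  config : Type;
  init : seq W -> config;
  step : config -> option (config * R);   (* next configuration, step cost *)
  halted : config -> bool;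
  output : config -> seq W
}.

Section Complexity.
Variables (R : realType) (W : word_arch).
Implicit Types (A : machine R W) (P : problem W).

Inductive runs A : config A -> R -> config A -> Prop :=
| Runs0 c : runs c 0 c
| RunsS c c1 c2 t1 t2 :
    step c = Some (c1, t1) -> runs c1 t2 c2 -> runs c (t1 + t2) c2.

(* A configuration that is not halted and has no successor is a crash. *)
Definition computes A (x : seq W) (t : R) (y : seq W) :=
  exists c : config A, [/\ runs (init A x) t c, halted c & output c = y].

Definition solves A P :=
  forall x, instance P x -> exists t y, computes A x t y /\ answer P x y.

Definition worst_case A P (n : nat) : \bar R :=
  ereal_sup [set t%:E | t in
    [set t : R | exists x y,
       [/\ instance P x, input_size P x = n & computes A x t y]]].

(* F bounds from below the worst-case cost on instances of size n (whenever
   there are any) of every algorithm [algo p] that solves P. *)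
Definition cost_lower_bound (prog : Type) (algo : prog -> machine R W)
    P (F : nat -> R) :=
  forall p, solves (algo p) P ->
  forall n, (exists x, instance P x /\ input_size P x = n) ->
  ((F n)%:E <= worst_case (algo p) P n)%E.

End Complexity.

Section Processor.
Variable W : word_arch.

Definition update (mem : memory W) (a : nat) (w : W) : memory W :=
  fun b => if b == a then w else mem b.

(* Operands: an address, or a base address held in cell a plus a displacement. *)
Inductive operand := Direct of nat | Indirect of nat & nat.

Definition address (mem : memory W) (o : operand) : nat :=
  match o with
  | Direct a => a
  | Indirect a d => (word_nat (mem a) + d)%N
  end.

Inductive word_op := OpAdd | OpMul | OpPrim of word_prim W.

Definition word_op_sem (o : word_op) : W -> W -> W :=
  match o with
  | OpAdd => +%R
  | OpMul => *%R
  | OpPrim p => prim_sem p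
  end.

Inductive instr :=
| IConst of operand & W
| IMove of operand & operand
| IOp of word_op & operand & operand & operand
| IJump of nat
| IJumpZero of operand & nat.

(* [ok] is the set of cells the processor has access to. *)
Definition pointer_ok (ok : pred nat) (o : operand) : bool :=
  if o is Indirect a _ then ok a else true.

Definition operand_ok (ok : pred nat) (mem : memory W) (o : operand) : bool :=
  pointer_ok ok o && ok (address mem o).

Definition instr_ok (ok : pred nat) (mem : memory W) (i : instr) : bool :=
  match i with
  | IConst o _ => operand_ok ok mem o
  | IMove o o1 => operand_ok ok mem o && operand_ok ok mem o1
  | IOp _ o o1 o2 =>
      [&& operand_ok ok mem o, operand_ok ok mem o1 & operand_ok ok mem o2]
  | IJump _ => true
  | IJumpZero o _ => operand_ok ok mem o
  end.

Definition exec (i : instr) (pc : nat) (mem : memory W) : nat * memory W :=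
  let val o := mem (address mem o) in
  match i with
  | IConst o w => (pc.+1, update mem (address mem o) w)
  | IMove o o1 => (pc.+1, update mem (address mem o) (val o1))
  | IOp op o o1 o2 =>
      (pc.+1, update mem (address mem o) (word_op_sem op (val o1) (val o2)))
  | IJump j => (j, mem)
  | IJumpZero o j => (if val o == 0 then j else pc.+1, mem)
  end.

End Processor.

Section ExternalMemory.
Variables (R : realType) (W : word_arch) (M B : nat).

(* External operands of [ERead] and [EWrite] are block numbers (block b consists
   of the words b * B, ..., b * B + B - 1), possibly computed from an internal
   word; internal operands are the address of the first of B cells. *)
Inductive em_instr :=
| ECpu of instr W
| ERead (ext int : operand)
| EWrite (int ext : operand).

Record em_config := EmConfig {
  em_pc : nat;
  em_int : memory W;   (* only the cells < M are accessible *)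
  em_ext : memory W
}.

Definition copy_block (src : memory W) (a : nat) (dst : memory W) (b : nat)
    : memory W :=
  fun x => if (b <= x < b + B)%N then src (a + (x - b))%N else dst x.

Definition transfer_ok (mem : memory W) (ext int : operand) : bool :=
  [&& pointer_ok (fun a => (a < M)%N) ext,
      pointer_ok (fun a => (a < M)%N) int & (address mem int + B <= M)%N].

Definition em_step (p : seq em_instr) (c : em_config)
    : option (em_config * R) :=
  let: EmConfig pc int ext := c in
  match onth p pc with
  | None => None
  | Some (ECpu i) =>
      if instr_ok (fun a => (a < M)%N) int i then
        let: (pc', int') := exec i pc int in Some (EmConfig pc' int' ext, 0)
      else None
  | Some (ERead e i) =>
      if transfer_ok int e i then
        Some (EmConfig pc.+1
          (copy_block ext (address int e * B)%N int (address int i)) ext, 1)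
      else None
  | Some (EWrite i e) =>
      if transfer_ok int e i then
        Some (EmConfig pc.+1 int
          (copy_block int (address int i) ext (address int e * B)%N), 1)
      else None
  end.

(* The cost of a run is its number of block transfers. *)
Definition em_machine (p : seq em_instr) : machine R W :=
  {| config := em_config;
     init x := EmConfig 0 (fun=> 0) (store_seq x);
     step := em_step p;
     halted c := (size p <= em_pc c)%N;
     output c := load_seq (em_ext c) |}.

End ExternalMemory.

Section WeakTCU.
(* s is the square root of m; theta m is the Theta(m) part of the cost of a call
   to the tensor unit, and l its latency. *)
Variables (R : realType) (W : word_arch) (theta : nat -> R) (s : nat) (l : R).

Inductive tcu_instr :=
| TRam of instr W
| TTensor (opA opB opC : operand).

Record tcu_config := TcuConfig { tcu_pc : nat; tcu_mem : memory W }.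

(* Matrices are stored row by row from address a on. *)
Definition load_mx (mem : memory W) (a : nat) : 'M[W]_s :=
  \matrix_(i, j) mem (a + i * s + j)%N.

Definition store_mx (mem : memory W) (a : nat) (C : 'M[W]_s) : memory W :=
  fun x =>
    if [pick ij : 'I_s * 'I_s | x == (a + ij.1 * s + ij.2)%N] is Some ij
    then C ij.1 ij.2 else mem x.

Definition tcu_step (p : seq tcu_instr) (c : tcu_config)
    : option (tcu_config * R) :=
  let: TcuConfig pc mem := c in
  match onth p pc with
  | None => None
  | Some (TRam i) =>
      let: (pc', mem') := exec i pc mem in Some (TcuConfig pc' mem', 1)
  | Some (TTensor oA oB oC) =>
      let C := load_mx mem (address mem oA) *m load_mx mem (address mem oB) in
      Some (TcuConfig pc.+1 (store_mx mem (address mem oC) C),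
            theta (s ^ 2)%N + l)
  end.

Definition tcu_machine (p : seq tcu_instr) : machine R W :=
  {| config := tcu_config;
     init x := TcuConfig 0 (store_seq x);
     step := tcu_step p;
     halted c := (size p <= tcu_pc c)%N;
     output c := load_seq (tcu_mem c) |}.

End WeakTCU.

Definition Theta_linear (R : realType) (theta : nat -> R) :=
  exists a b : R, [/\ 0 < a, 0 < b &
    forall m : nat, (0 < m)%N -> a * m%:R <= theta m <= b * m%:R].

(* Main.v *)
Require Import Defs.
From HB Require Import structures.
From mathcomp Require Import all_boot all_order all_algebra.
From mathcomp Require Import all_classical all_reals ereal.
From mathcomp Require Import zify.

Set Implicit Arguments.
Unset Strict Implicit.
Unset Printing Implicit Defensive.

Import Order.TTheory GRing.Theory Num.Theory.
Local Open Scope ring_scope.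

(** A weak TCU program is translated, instruction by instruction, into an
    external-memory program whose external memory is the memory of the TCU:
    a RAM instruction fetches its operands and stores its result with at most 6
    transfers, and a call to the tensor unit loads both matrices, multiplies
    them inside the internal memory for free, and stores the product, with at
    most [3 m + 3 <= 6 m] transfers.  Hence every run of the TCU of time [t] is
    simulated with [O(t)] transfers; since machines are deterministic, the
    worst cases compare in the same way. *)

(** * Runs of a deterministic machine *)

Section Runs.
Variables (R : realType) (W : word_arch) (A : machine R W).

Lemma runs_trans (c1 c2 c3 : config A) t1 t2 :
  runs c1 t1 c2 -> runs c2 t2 c3 -> runs c1 (t1 + t2) c3.
Proof.
elim=> [c|c c' c'' u1 u2 st _ IH] r; first by rewrite add0r.
by rewrite -addrA; apply: RunsS st (IH r).
Qed.

Lemma runs_step (c c' : config A) t : step c = Some (c', t) -> runs c t c'.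
Proof. by move=> st; rewrite -[t]addr0; apply: RunsS st (Runs0 _). Qed.

(** [step] is a function, so both runs take the same steps, and neither can stop earlier: its stuck
    end would be a configuration that the other one leaves. This is what makes the cost of an input
    well defined. *)
Lemma runs_stuck_unique (c c1 c2 : config A) t1 t2 :
  runs c t1 c1 -> step c1 = None -> runs c t2 c2 -> step c2 = None ->
  t1 = t2 /\ c1 = c2.
Proof.
move=> r1; elim: r1 t2 => [c0|c0 c' c'' u1 u2 st _ IH] t2 st1 r2 st2.
  by inversion r2 as [|? ? ? ? ? st']; subst => //; rewrite st' in st1.
inversion r2 as [|? d ? v1 v2 st' r']; subst; first by rewrite st2 in st.
move: st'; rewrite st => -[ec et]; subst.
by have [-> ->] := IH _ st1 r' st2.
Qed.

End Runs.

(** * Straight-line external-memory code at block length 1 *)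

Lemma copy_block1 (W : word_arch) (src dst : memory W) a b :
  copy_block 1 src a dst b = update dst b (src a).
Proof.
apply/funext => x; rewrite /copy_block /update.
have [->|ne] := eqVneq x b; first by rewrite addn1 leqnn ltnSn subnn addn0.
by rewrite (_ : (_ <= _ < _)%N = false) //; lia.
Qed.

Section Blocks.
Variables (R : realType) (W : word_arch) (M : nat).
Implicit Types (q : seq (em_instr W)) (int ext : memory W)
  (Q : memory W -> memory W -> Prop).

Definition code_at (p : seq (em_instr W)) pc q :=
  exists p1 p2, p = p1 ++ q ++ p2 /\ size p1 = pc.

(* Straight-line code [q], wherever it occurs in a program, takes the memories
   [int], [ext] to memories satisfying [Q] with at most [n] transfers. *)
Definition block q n Q int ext :=
  exists int' ext' (t : nat),
    [/\ forall p pc, code_at p pc q ->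
          @runs R W (em_machine R M 1 p) (EmConfig pc int ext) t%:R
            (EmConfig (pc + size q) int' ext'),
        (t <= n)%N & Q int' ext'].

Lemma code_at_cat p pc q1 q2 :
  code_at p pc (q1 ++ q2) ->
  code_at p pc q1 /\ code_at p (pc + size q1) q2.
Proof.
case=> p1 [p2 [-> <-]]; split.
  by exists p1, (q2 ++ p2); rewrite -!catA.
by exists (p1 ++ q1), p2; rewrite -!catA size_cat.
Qed.

Lemma onth_code_at p pc i q : code_at p pc (i :: q) -> onth p pc = Some i.
Proof.
by case=> p1 [p2 [-> <-]]; rewrite onth_cat ltnn subnn.
Qed.

Lemma block_weaken q n n' Q Q' int ext :
  (n <= n')%N -> (forall i e, Q i e -> Q' i e) ->
  block q n Q int ext -> block q n' Q' int ext.
Proof.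
move=> le_n sub [i [e [t [r le_t q0]]]]; exists i, e, t; split=> //.
  exact: leq_trans le_n.
exact: sub.
Qed.

Lemma block_nil Q int ext : Q int ext -> block [::] 0 Q int ext.
Proof.
move=> q0; exists int, ext, 0%N; split=> // p pc _.
by rewrite addn0; apply: Runs0.
Qed.

Lemma block_cat q1 q2 n1 n2 Q1 Q2 int ext :
  block q1 n1 Q1 int ext ->
  (forall i e, Q1 i e -> block q2 n2 Q2 i e) ->
  block (q1 ++ q2) (n1 + n2) Q2 int ext.
Proof.
move=> [i [e [t [r le_t q0]]]] /(_ _ _ q0)[i' [e' [t' [r' le_t' q0']]]].
exists i', e', (t + t')%N; split=> //; last exact: leq_add.
move=> p pc /code_at_cat[c1 c2].
by rewrite natrD size_cat addnA; apply: runs_trans (r _ _ c1) (r' _ _ c2).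
Qed.

Lemma block_cpu (i : instr W) int ext Q int' :
  instr_ok (fun a => (a < M)%N) int i ->
  (forall pc, exec i pc int = (pc.+1, int')) ->
  Q int' ext -> block [:: ECpu i] 0 Q int ext.
Proof.
move=> ok ex q0; exists int', ext, 0%N; split=> // p pc /onth_code_at on.
by apply: runs_step; rewrite /= on ok ex addn1.
Qed.

Lemma block_read e (i : nat) int ext Q :
  (i < M)%N -> pointer_ok (fun a => (a < M)%N) e ->
  Q (update int i (ext (address int e))) ext ->
  block [:: ERead W e (Direct i)] 1 Q int ext.
Proof.
move=> lt_i ok q0; eexists _, _, 1%N; split; [|by []|exact: q0].
move=> p pc /onth_code_at on.
apply: runs_step; rewrite /= on /transfer_ok ok /= !addn1 lt_i.
by rewrite copy_block1 muln1.
Qed.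

Lemma block_write e (i : nat) int ext Q :
  (i < M)%N -> pointer_ok (fun a => (a < M)%N) e ->
  Q int (update ext (address int e) (int i)) ->
  block [:: EWrite W (Direct i) e] 1 Q int ext.
Proof.
move=> lt_i ok q0; eexists _, _, 1%N; split; [|by []|exact: q0].
move=> p pc /onth_code_at on.
apply: runs_step; rewrite /= on /transfer_ok ok /= !addn1 lt_i.
by rewrite copy_block1 muln1.
Qed.

(** Every iteration count depends only on [s], which is fixed before the program is written;
    unrolling avoids jumps and loop counters in the scarce internal memory. *)
Definition unroll (f : nat -> seq (em_instr W)) n := flatten (mkseq f n).

Lemma block_unroll (I : nat -> memory W -> memory W -> Prop) f n b int ext :
  (forall t i e, (t < n)%N -> I t i e -> block (f t) b (I t.+1) i e) ->
  I 0%N int ext -> block (unroll f n) (n * b) (I n) int ext.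
Proof.
elim: n => [|n IH] stp I0; first exact: block_nil.
rewrite /unroll mkseqS flatten_rcons mulSnr; apply: (block_cat (Q1 := I n)).
  by apply: IH I0 => t i e lt_t; apply: stp; apply: ltnW.
by move=> i e; apply: stp.
Qed.

(* Internal cell 0 caches the pointer of an indirect operand. *)
Definition fetch (o : operand) : seq (em_instr W) :=
  if o is Indirect a _ then [:: ERead W (Direct a) (Direct 0)] else [::].

(** With blocks of one word, block numbers are addresses, so shifting the displacement by [t]
    reaches the [t]-th word after the operand. An indirect operand now goes through the pointer
    cached in cell 0. *)
Definition fetched (o : operand) (t : nat) : operand :=
  match o with
  | Direct a => Direct (a + t)
  | Indirect _ d => Indirect 0 (d + t)
  end.

Definition load_block o r n :=
  fetch o ++ unroll (fun t => [:: ERead W (fetched o t) (Direct (r + t))]) n.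

Definition store_block r o n :=
  fetch o ++ unroll (fun t => [:: EWrite W (Direct (r + t)) (fetched o t)]) n.

Hypothesis M_gt0 : (0 < M)%N.

Lemma fetched_ok o t : pointer_ok (fun a => (a < M)%N) (fetched o t).
Proof. by case: o. Qed.

Lemma block_fetch o int ext :
  block (fetch o) 1 (fun int' ext' =>
    [/\ ext' = ext,
        forall t, address int' (fetched o t) = (address ext o + t)%N
      & forall x, (0 < x)%N -> int' x = int x]) int ext.
Proof.
case: o => [a|a d] /=.
  by apply: (block_weaken (leq0n 1) (fun _ _ => id)); apply: block_nil.
apply: block_read => //=; split=> // [t|x x_gt0]; first by rewrite addnA.
by rewrite /update gtn_eqF.
Qed.

(** At most one transfer for the pointer and one per word. The frame condition, which leaves out
    cell 0, lets words loaded earlier survive later loads. *)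
Lemma block_load o r n int ext : (0 < r)%N -> (r + n <= M)%N ->
  block (load_block o r n) n.+1 (fun int' ext' =>
    [/\ ext' = ext,
        forall t, (t < n)%N -> int' (r + t)%N = ext (address ext o + t)%N
      & forall x, (0 < x)%N -> ~~ (r <= x < r + n)%N -> int' x = int x])
    int ext.
Proof.
move=> r_gt0 le_M; rewrite -add1n -[n in (1 + n)%N]muln1.
apply: block_cat (block_fetch _ _ _) _ => i e [-> adr frame].
(* The cached pointer in cell 0 is part of the invariant, since each read computes its address from
   it; [0 < r] protects it. *)
pose I k (int' ext' : memory W) :=
  [/\ ext' = ext, int' 0%N = i 0%N,
      forall t, (t < k)%N -> int' (r + t)%N = ext (address ext o + t)%N
    & forall x, (0 < x)%N -> ~~ (r <= x < r + k)%N -> int' x = int x].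
apply: (block_weaken (n := (n * 1)%N) (Q := I n)) => //.
  by move=> i' e' [].
apply: (block_unroll (I := I)); last by split=> // x x_gt0 _; exact: frame.
move=> t i' e' lt_t [-> i'0 val frame'].
apply: block_read; [lia | exact: fetched_ok |].
have adr' : address i' (fetched o t) = (address ext o + t)%N.
  by rewrite -adr; case: (o) => //= a d; rewrite i'0.
rewrite adr'; split=> //.
- by rewrite /update ifN //; lia.
- move=> u lt_u; rewrite /update eqn_add2l; have [-> //|ne] := eqVneq u t.
  by apply: val; lia.
- move=> x x_gt0 x_out; rewrite /update ifN; last by lia.
  by apply: frame' => //; lia.
Qed.

Lemma block_store r o n int ext : (0 < r)%N -> (r + n <= M)%N ->
  block (store_block r o n) n.+1 (fun _ ext' =>
    ext' = fun x => if (address ext o <= x < address ext o + n)%N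
                    then int (r + (x - address ext o))%N else ext x)
    int ext.
Proof.
move=> r_gt0 le_M; rewrite -add1n -[n in (1 + n)%N]muln1.
apply: block_cat (block_fetch _ _ _) _ => i e [-> adr frame].
(* Writes leave the internal memory alone, so the target address stays the one computed from the
   initial [ext], even when the pointer's own external cell gets overwritten. *)
pose I k (int' ext' : memory W) := int' = i /\
  ext' = fun x => if (address ext o <= x < address ext o + k)%N
                  then int (r + (x - address ext o))%N else ext x.
apply: (block_weaken (n := (n * 1)%N) (Q := I n)) => //.
  by move=> i' e' [].
apply: (block_unroll (I := I)); last first.
  by split=> //; apply/funext => x; rewrite ifF //; lia.
move=> t i' e' lt_t [-> ->].
apply: block_write; [lia | exact: fetched_ok |].
rewrite adr frame; last by lia.
split=> //; apply/funext => x; rewrite /update /=.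
have [->|ne] := eqVneq x (address ext o + t)%N.
  by rewrite ifT; [congr (int _)|]; lia.
by congr (if _ then _ else _); lia.
Qed.

Lemma block_load1 o r int ext : (0 < r < M)%N ->
  block (load_block o r 1) 2 (fun int' ext' =>
    [/\ ext' = ext, int' r = ext (address ext o)
      & forall x, (0 < x)%N -> x != r -> int' x = int x]) int ext.
Proof.
move=> /andP[r_gt0 lt_r]; apply: block_weaken (block_load _ _ _ _ _) => //.
  move=> i e [-> val frame]; split=> // [|x x_gt0 ne].
    by have := val 0%N isT; rewrite !addn0.
  by apply: frame => //; lia.
by rewrite addn1.
Qed.

Lemma block_store1 r o int ext : (0 < r < M)%N ->
  block (store_block r o 1) 2
    (fun _ ext' => ext' = update ext (address ext o) (int r)) int ext.
Proof.
move=> /andP[r_gt0 lt_r]; apply: block_weaken (block_store _ _ _ _ _) => //.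
  move=> i e ->; apply/funext => x; rewrite /update /=.
  have [->|ne] := eqVneq x (address ext o).
    by rewrite addn1 leqnn ltnSn subnn addn0.
  by rewrite ifF //; lia.
by rewrite addn1.
Qed.

(* [C := A B] for s x s matrices stored row by row in the internal memory from
   the cells [a], [b] and [c] on; cell 1 holds the current product. *)
Definition mulmx_code s a b c :=
  unroll (fun t =>
    ECpu (IConst (Direct (c + t)) 0) ::
    unroll (fun k =>
      [:: ECpu (IOp (OpMul W) (Direct 1) (Direct (a + (t %/ s * s + k)))
                 (Direct (b + (k * s + t %% s))));
          ECpu (IOp (OpAdd W) (Direct (c + t)) (Direct (c + t)) (Direct 1))]) s)
  (s * s).

Lemma block_mulmx s a b c int ext :
  (1 < a)%N -> (a + s * s <= b)%N -> (b + s * s <= c)%N ->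
  (c + s * s <= M)%N ->
  block (mulmx_code s a b c) 0 (fun int' ext' => ext' = ext /\
    forall t, (t < s * s)%N -> int' (c + t)%N =
      \sum_(k < s) int (a + (t %/ s * s + k))%N * int (b + (k * s + t %% s))%N)
    int ext.
Proof.
move=> a_gt1 le_ab le_bc le_cM.
(* The first [n] terms of the product entry in row [t %/ s] and column [t %% s]. *)
pose dot t n := \sum_(k < n)
  int (a + (t %/ s * s + k))%N * int (b + (k * s + t %% s))%N.
(* Outer invariant: the first [k] entries are final. The cells holding the factors lie strictly
   between the scratch cell 1 and [c], and stay intact. *)
pose I k (int' ext' : memory W) :=
  [/\ ext' = ext, forall x, (1 < x < c)%N -> int' x = int x
    & forall t, (t < k)%N -> int' (c + t)%N = dot t s].
apply: (block_weaken (n := (s * s * 0)%N) (Q := I (s * s)%N)).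
- by rewrite muln0.
- by move=> i e [].
apply: (block_unroll (I := I)) => // t i e lt_t [-> frame val].
have s_gt0 : (0 < s)%N by case: (s) lt_t.
have lt_div : (t %/ s < s)%N by rewrite ltn_divLR.
have lt_mod : (t %% s < s)%N by rewrite ltn_mod.
(* Inner invariant: in addition, cell [c + t] accumulates the first [k] terms of entry [t]. *)
pose J k (int' ext' : memory W) :=
  [/\ ext' = ext, forall x, (1 < x < c)%N -> int' x = int x,
      forall u, (u < t)%N -> int' (c + u)%N = dot u s
    & int' (c + t)%N = dot t k].
rewrite -cat1s -[0%N]/(0 + 0)%N; apply: (block_cat (Q1 := J 0%N)).
  apply: block_cpu => [|pc|].
  - by rewrite /= /operand_ok /=; lia.
  - by [].
  split=> // [x x_in|u lt_u|]; rewrite /update /=.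
  - by rewrite ifN ?frame //; lia.
  - by rewrite ifN ?val //; lia.
  - by rewrite eqxx /dot big_ord0.
move=> i1 e1 J0.
apply: (block_weaken (n := (s * 0)%N) (Q := J s)).
- by rewrite muln0.
- move=> i2 e2 [-> fr2 val2 valt]; split=> // u.
  by rewrite ltnS leq_eqVlt => /predU1P[->|/val2].
apply: (block_unroll (I := J)) J0 => k i2 e2 lt_k [-> fr2 val2 valt].
have lt_A : (t %/ s * s + k < s * s)%N.
  apply: (@leq_trans ((t %/ s).+1 * s)%N); first by rewrite mulSnr ltn_add2l.
  by rewrite leq_mul2r lt_div orbT.
have lt_B : (k * s + t %% s < s * s)%N.
  apply: (@leq_trans (k.+1 * s)%N); first by rewrite mulSnr ltn_add2l.
  by rewrite leq_mul2r lt_k orbT.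
(* Both factors are read from the area that the invariants keep unchanged. *)
have in_A : (1 < a + (t %/ s * s + k) < c)%N.
  by move: (t %/ s * s + k)%N lt_A => u lt_u; lia.
have in_B : (1 < b + (k * s + t %% s) < c)%N.
  by move: (k * s + t %% s)%N lt_B => u lt_u; lia.
rewrite -cat1s -[0%N]/(0 + 0)%N.
pose K (int' ext' : memory W) := J k int' ext' /\ int' 1%N =
  int (a + (t %/ s * s + k))%N * int (b + (k * s + t %% s))%N.
apply: (block_cat (Q1 := K)).
  apply: block_cpu => [|pc|].
  - by rewrite /= /operand_ok /=; apply/and3P; split; lia.
  - by [].
  rewrite /= !fr2 ?in_A ?in_B //.
  split; last by rewrite /update eqxx.
  split=> // [x x_in|u lt_u|]; rewrite /update /=.
  - by rewrite ifN ?fr2 //; lia.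
  - by rewrite ifN ?val2 //; lia.
  - by rewrite ifN ?valt //; lia.
move=> i3 e3 [[-> fr3 val3 valt3] prod].
apply: block_cpu => [|pc|].
- by rewrite /= /operand_ok /=; apply/and3P; split; lia.
- by [].
rewrite /= valt3 prod; split=> // [x x_in|u lt_u|]; rewrite /update /=.
- by rewrite ifN ?fr3 //; lia.
- by rewrite ifN ?val3 //; lia.
- by rewrite eqxx /dot big_ord_recr.
Qed.

End Blocks.

(** Whichever index pair [pick] returns, its row-major offset is [x - a], and [v] fixes the entry
    from that offset. Euclidean division of [x - a] by [s] supplies a pair for every cell in
    range. *)
Lemma store_mxE (W : word_arch) s (mem : memory W) a (C : 'M[W]_s)
    (v : nat -> W) :
  (forall i j : 'I_s, v (i * s + j)%N = C i j) ->
  store_mx mem a C =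
    fun x => if (a <= x < a + s * s)%N then v (x - a)%N else mem x.
Proof.
move=> vE; apply/funext => x; rewrite /store_mx.
case: pickP => [[i j] /= /eqP ->|no].
  have lt_ij : (i * s + j < s * s)%N.
    apply: (@leq_trans (i.+1 * s)%N); first by rewrite mulSnr ltn_add2l.
    by rewrite leq_mul2r ltn_ord orbT.
  rewrite ifT; last by lia.
  by rewrite -vE; congr v; lia.
case: ifP => // /andP[le_a lt_x].
have lt_t : (x - a < s * s)%N by lia.
have s_gt0 : (0 < s)%N by case: (s) lt_t; rewrite ?muln0.
have lt_div : ((x - a) %/ s < s)%N by rewrite ltn_divLR.
have lt_mod : ((x - a) %% s < s)%N by rewrite ltn_mod.
have := no (Ordinal lt_div, Ordinal lt_mod).
by rewrite /= -addnA -divn_eq subnKC // eqxx.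
Qed.

(** * Translating and simulating single TCU instructions *)

Section Simulation.
Variables (R : realType) (W : word_arch) (theta : nat -> R) (s : nat) (l : R).
Variables (M : nat).
Hypothesis M_large : (3 * (s * s) + 3 <= M)%N.
Hypothesis s_gt0 : (0 < s)%N.

Let M_gt0 : (0 < M)%N. Proof. lia. Qed.

(** Layout: cell 0 caches pointers, cell 1 is scratch, and the two factors and the product follow
    from cell 2 on, [m] cells each. *)
Definition tensor_code oA oB oC : seq (em_instr W) :=
  let m := (s * s)%N in
  load_block W oA 2 m ++ load_block W oB (2 + m) m ++
  mulmx_code W s 2 (2 + m) (2 + m + m) ++ store_block W (2 + m + m) oC m.

Lemma block_tensor oA oB oC int ext :
  block R M (tensor_code oA oB oC) (3 * (s * s) + 3) (fun _ ext' =>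
    ext' = store_mx ext (address ext oC)
      (load_mx s ext (address ext oA) *m load_mx s ext (address ext oB)))
    int ext.
Proof.
set m := (s * s)%N.
(* Two loads and one store of [m] words, each with a possible pointer fetch; the product itself is
   free. *)
have -> : (3 * m + 3 = m.+1 + (m.+1 + (0 + m.+1)))%N by lia.
apply: block_cat (block_load _ _ _ _ _ _ _) _ => //; first by lia.
move=> i1 _ [-> valA _].
apply: block_cat (block_load _ _ _ _ _ _ _) _ => //; first by lia.
move=> i2 _ [-> valB frame].
apply: block_cat (block_mulmx _ _ _ _ _ _ _ _) _ => //; try lia.
move=> i3 _ [-> valC].
apply: block_weaken (block_store _ _ _ _ _ _ _) => //; last by lia.
move=> _ _ ->.
rewrite (@store_mxE _ _ _ _ _ (fun t => i3 (2 + m + m + t)%N)) // => i j.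
have lt_ij (u v : nat) : (u < s)%N -> (v < s)%N -> (u * s + v < m)%N.
  move=> lt_u lt_v; apply: (@leq_trans (u.+1 * s)%N).
    by rewrite mulSnr ltn_add2l.
  by rewrite leq_mul2r lt_u orbT.
rewrite valC ?lt_ij // mxE; apply: eq_bigr => k _.
rewrite divnMDl // divn_small // addn0 modnMDl modn_small // !mxE.
have ltA := lt_ij i k (ltn_ord i) (ltn_ord k).
have ltB := lt_ij k j (ltn_ord k) (ltn_ord j).
(* The left factor has survived the loading of the right one. *)
rewrite valB // frame; try lia.
by rewrite valA // !addnA.
Qed.

(* [off] maps the program counters of the TCU to those of the simulation. *)
Definition compile (off : nat -> nat) (i : tcu_instr W) : seq (em_instr W) :=
  match i with
  | TRam (IConst o w) =>
      ECpu (IConst (Direct 1) w) :: store_block W 1 o 1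
  | TRam (IMove o o1) => load_block W o1 1 1 ++ store_block W 1 o 1
  | TRam (IOp op o o1 o2) =>
      load_block W o1 1 1 ++ load_block W o2 2 1 ++
      [:: ECpu (IOp op (Direct 1) (Direct 1) (Direct 2))] ++ store_block W 1 o 1
  | TRam (IJump j) => [:: ECpu (IJump W (off j))]
  | TRam (IJumpZero o j) =>
      rcons (load_block W o 1 1) (ECpu (IJumpZero W (Direct 1) (off j)))
  | TTensor oA oB oC => tensor_code oA oB oC
  end.

Lemma size_compile off off' i : size (compile off i) = size (compile off' i).
Proof. by case: i => [[]|] //= *; rewrite !size_rcons. Qed.

(* The size of compiled code does not depend on jump targets, so [id] will do. *)
Definition offset (p : seq (tcu_instr W)) (pc : nat) : nat :=
  size (flatten (map (compile id) (take pc p))).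

Definition compile_prog (p : seq (tcu_instr W)) : seq (em_instr W) :=
  flatten (map (compile (offset p)) p).

Lemma size_flatten_compile off off' p :
  size (flatten (map (compile off) p)) = size (flatten (map (compile off') p)).
Proof.
by elim: p => //= i p IH; rewrite !size_cat IH (size_compile off off').
Qed.

(** A jump may land anywhere beyond the end of [p]; all such counters map to the end of the compiled
    program, so halting is preserved. *)
Lemma offset_oversize p pc :
  (size p <= pc)%N -> offset p pc = size (compile_prog p).
Proof.
by move=> le_p; rewrite /offset take_oversize //; apply: size_flatten_compile.
Qed.

Lemma code_at_compile p pc i : onth p pc = Some i ->
  code_at (compile_prog p) (offset p pc) (compile (offset p) i) /\
  offset p pc.+1 = (offset p pc + size (compile (offset p) i))%N.
Proof.
move=> on; have lt_pc : (pc < size p)%N by rewrite -onthTE on.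
have nthE : nth i p pc = i by apply: onth_nth; rewrite on.
split.
  exists (flatten (map (compile (offset p)) (take pc p))),
    (flatten (map (compile (offset p)) (drop pc.+1 p))); split.
    rewrite /compile_prog; move: (compile (offset p)) => f.
    rewrite -[in LHS](cat_take_drop pc p) (drop_nth i) // nthE.
    by rewrite map_cat flatten_cat.
  exact: size_flatten_compile.
rewrite /offset (take_nth i) // nthE map_rcons flatten_rcons size_cat.
by rewrite (size_compile id (offset p)).
Qed.

Lemma simulate_block p pc i n int ext ext' : onth p pc = Some i ->
  block R M (compile (offset p) i) n (fun _ e => e = ext') int ext ->
  exists int' (t : nat), (t <= n)%N /\
    @runs R W (em_machine R M 1 (compile_prog p))
      (EmConfig (offset p pc) int ext) t%:R
      (EmConfig (offset p pc.+1) int' ext').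
Proof.
move=> /code_at_compile[cd ->] [i' [e' [t [r le_t <-]]]].
by exists i', t; split=> //; apply: r.
Qed.

Lemma simulate_instr p pc i int ext : onth p pc = Some (TRam i) ->
  exists int' (t : nat), (t <= 6)%N /\
    @runs R W (em_machine R M 1 (compile_prog p))
      (EmConfig (offset p pc) int ext) t%:R
      (EmConfig (offset p (exec i pc ext).1) int' (exec i pc ext).2).
Proof.
case: i => [o w|o o1|op o o1 o2|j|o j] on.
- apply: (simulate_block on); rewrite /compile -cat1s.
  apply: (block_weaken (n := (0 + 2)%N) _ (fun _ _ => id)) => //.
  apply: (block_cat (Q1 := fun i e => e = ext /\ i 1%N = w)).
    by apply: block_cpu => //; rewrite /= /operand_ok /=; lia.
  move=> i _ [-> i1].
  apply: block_weaken (block_store1 _ _ _ _ _ _) => //; last by lia.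
  by move=> ? ? ->; rewrite i1.
- apply: (simulate_block on); rewrite /compile.
  apply: (block_weaken (n := (2 + 2)%N) _ (fun _ _ => id)) => //.
  apply: block_cat (block_load1 _ _ _ _ _ _) _ => //; first by lia.
  move=> i _ [-> i1 _].
  apply: block_weaken (block_store1 _ _ _ _ _ _) => //; last by lia.
  by move=> ? ? ->; rewrite i1.
- apply: (simulate_block on); rewrite /compile.
  (* The most expensive RAM instruction: three operands, each costing at most a pointer and a
     word. *)
  apply: (block_weaken (n := (2 + (2 + (0 + 2)))%N) _ (fun _ _ => id)) => //.
  apply: block_cat (block_load1 _ _ _ _ _ _) _ => //; first by lia.
  move=> i _ [-> i1 _].
  apply: block_cat (block_load1 _ _ _ _ _ _) _ => //; first by lia.
  move=> i' _ [-> i2 frame].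
  apply: (block_cat (Q1 := fun i e => e = ext /\
    i 1%N = word_op_sem op (ext (address ext o1)) (ext (address ext o2)))).
    apply: block_cpu => //; first by rewrite /= /operand_ok /=; lia.
    by rewrite /= /update eqxx frame // i1 i2.
  move=> i3 _ [-> i31].
  apply: block_weaken (block_store1 _ _ _ _ _ _) => //; last by lia.
  by move=> ? ? ->; rewrite i31.
- have [/onth_code_at on' _] := code_at_compile on.
  by exists int, 0%N; split=> //; apply: runs_step; rewrite /= on'.
- have [] := code_at_compile on; rewrite /compile -cats1 => cd off_next.
  have [cd1 /onth_code_at on'] := code_at_cat cd.
  have [|i [e [t [r le_t [e_ext i1 _]]]]] :=
      @block_load1 R W M M_gt0 o 1 int ext; first by lia.
  rewrite {}e_ext in r; exists i, t; split; first exact: leq_trans le_t _.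
  rewrite -[t%:R]addr0; apply: runs_trans (r _ _ cd1) _.
  apply: runs_step; rewrite /= on' /= /operand_ok /= ifT; last by lia.
  (* A jump not taken falls off the end of the compiled block, which is the offset of [pc.+1]. *)
  by rewrite i1; case: ifP => //= _; rewrite off_next size_cat addn1 addnS.
Qed.

(** * Cost accounting along whole runs *)

Variables (c : R).
Hypothesis c_ram : 6 <= c.
Hypothesis c_tensor : (3 * (s * s) + 3)%:R <= c * (theta (s ^ 2)%N + l).

Lemma simulate_step p cf cf' t int :
  tcu_step theta s l p cf = Some (cf', t) ->
  exists int' (u : R), u <= c * t /\
    @runs R W (em_machine R M 1 (compile_prog p))
      (EmConfig (offset p (tcu_pc cf)) int (tcu_mem cf)) u
      (EmConfig (offset p (tcu_pc cf')) int' (tcu_mem cf')).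
Proof.
case: cf => pc mem /=; case on: (onth p pc) => [[i|oA oB oC]|//].
  have [int' [u [le_u r]]] := simulate_instr int mem on.
  case ex: (exec i pc mem) => [pc' mem'] [<- <-] /=.
  exists int', u%:R; rewrite ex in r; split=> //; rewrite mulr1.
  by apply: le_trans c_ram; rewrite ler_nat.
case=> <- <-; have [int' [u [le_u r]]] :=
  simulate_block on (block_tensor oA oB oC int mem).
exists int', u%:R; split=> //.
by apply: le_trans c_tensor; rewrite ler_nat.
Qed.

Lemma simulate_runs p (cf cf' : tcu_config W) t int :
  @runs R W (tcu_machine theta s l p) cf t cf' ->
  exists int' (u : R), u <= c * t /\
    @runs R W (em_machine R M 1 (compile_prog p))
      (EmConfig (offset p (tcu_pc cf)) int (tcu_mem cf)) u
      (EmConfig (offset p (tcu_pc cf')) int' (tcu_mem cf')).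
Proof.
move=> r; elim: r int => [cf0|cf0 cf1 cf2 t1 t2 st _ IH] int.
  by exists int, 0; rewrite mulr0; split=> //; apply: Runs0.
have [i1 [u1 [le1 r1]]] := simulate_step int st.
have [i2 [u2 [le2 r2]]] := IH i1.
by exists i2, (u1 + u2); rewrite mulrDr lerD //; split=> //; apply: runs_trans r2.
Qed.

Lemma simulate_computes p x t y :
  computes (tcu_machine theta s l p) x t y ->
  exists2 u : R, u <= c * t & computes (em_machine R M 1 (compile_prog p)) x u y.
Proof.
case=> cf [r hlt <-]; have [int' [u [le_u r']]] := simulate_runs (fun=> 0) r.
exists u => //.
exists (EmConfig (offset p (tcu_pc cf)) int' (tcu_mem cf)); split=> //.
  by move: r'; rewrite /= {1}/offset take0.
by rewrite /= offset_oversize.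
Qed.

End Simulation.

(** * Determinism and the comparison of worst cases *)

Lemma em_computes_unique (R : realType) (W : word_arch) M B p x t t' y y' :
  @computes R W (em_machine R M B p) x t y ->
  @computes R W (em_machine R M B p) x t' y' -> t = t' /\ y = y'.
Proof.
(* A halted counter points past the last instruction, so halted configurations are stuck. *)
have stuck (cf : em_config W) : (size p <= em_pc cf)%N ->
    em_step R M B p cf = None.
  by case: cf => pc int ext /= le_p; rewrite onth_default.
move=> [c1 [r1 h1 <-]] [c2 [r2 h2 <-]].
by have [-> ->] := runs_stuck_unique r1 (stuck _ h1) r2 (stuck _ h2).
Qed.

Theorem theorem12 (R : realType) (theta : nat -> R) :
  Theta_linear theta ->
  exists (k0 : nat) (c : R), 0 < c /\
  forall (W : word_arch) (m s k : nat) (l : R) (P : problem W) (F : nat -> R),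
    (1 <= m)%N -> (s ^ 2)%N = m -> 0 <= l -> (k0 <= k)%N ->
    cost_lower_bound (@em_machine R W (3 * m + k) 1) P F ->
    cost_lower_bound (@tcu_machine R W theta s l) P (fun n => c * F n).
Proof.
case=> a [b [a_gt0 _ theta_ge]].
(* The summand 6 pays for a RAM instruction of cost 1. Since [a * m <= theta m], the summand [6 / a]
   turns a tensor call into at least [6 m] transfers, and [3 m + 3 <= 6 m] because [1 <= m]. *)
pose C : R := 6 + 6 / a.
have C_gt0 : 0 < C by rewrite addr_gt0 // divr_gt0.
exists 3%N, C^-1; split; first by rewrite invr_gt0.
move=> W m s k l P F m_gt0 sm l_ge0 k_ge lbF p sol n ex.
have ssm : (s * s)%N = m by rewrite -sm expnS expn1.
have s_gt0 : (0 < s)%N by case: (s) ssm m_gt0 => // <-.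
have M_large : (3 * (s * s) + 3 <= 3 * m + k)%N by rewrite ssm leq_add2l.
have C_ram : 6 <= C by rewrite lerDl divr_ge0 // ltW.
have C_tensor : (3 * (s * s) + 3)%:R <= C * (theta (s ^ 2)%N + l).
  rewrite ssm sm; have /andP[theta_m _] := theta_ge m m_gt0.
  apply: (@le_trans _ _ (6 / a * (a * m%:R))).
    by rewrite mulrA divfK ?gt_eqF // -natrM ler_nat; lia.
  apply: ler_pM.
  - by rewrite divr_ge0 // ltW.
  - by rewrite mulr_ge0 // ltW.
  - by rewrite lerDr.
  - by rewrite (le_trans theta_m) // lerDl.
have sim x t y :=
  @simulate_computes R W theta s l _ M_large s_gt0 C C_ram C_tensor p x t y.
have solE : solves (em_machine R (3 * m + k) 1 (compile_prog s p)) P.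
  move=> x /sol[t [y [/sim[u _ cu] ans]]].
  by exists u, y.
have le_F := lbF _ solE n ex.
have le_W : (worst_case (em_machine R (3 * m + k) 1 (compile_prog s p)) P n
    <= C%:E * worst_case (tcu_machine theta s l p) P n)%E.
  (* Given a simulator run of cost [u] on [x], the TCU also halts on [x] because [p] solves [P];
     simulating that run costs at most [C * t], and by determinism this cost is [u]. *)
  apply: ub_ereal_sup => _ [u [x [y [xP xn cu]]] <-].
  have [t [y' [ct _]]] := sol x xP.
  have [u' le_u' cu'] := sim _ _ _ ct.
  have [-> _] := em_computes_unique cu cu'.
  apply: (@le_trans _ _ (C%:E * t%:E)%E); first by rewrite -EFinM lee_fin.
  apply: lee_wpmul2l; first by rewrite lee_fin ltW.
  by apply: ereal_sup_ubound; exists t => //; exists x, y'.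
rewrite EFinM.
(* The worst case may be infinite, so [C] is cancelled by associativity of the product in the
   extended reals. *)
have -> : worst_case (tcu_machine theta s l p) P n =
    (C^-1%:E * (C%:E * worst_case (tcu_machine theta s l p) P n))%E.
  by rewrite muleA -EFinM mulVf ?gt_eqF // mul1e.
apply: lee_wpmul2l; first by rewrite lee_fin invr_ge0 ltW.
exact: le_trans le_F le_W.
Qed.
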